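(* Let $A$ be a commutative ring, $k\ge1$, $\vec s=(n_1,\dots,n_k)$ a tuple of positive integers, $X_\bullet=X_\bullet(\vec s;A)$ the diagonal simplicial tensor module, $p\ge1$ and $0\le j\le p$. The horn kernel $R_{p,j}$ is a free $A$-module with basis $\{E_m\}_{m\in M_{p,j}}$. Consequently, if $T_1,T_2\in X_p$ are two fillers of the same $(p,j)$-horn, their difference is supported on the missing indices: $\operatorname{supp}(T_1-T_2)\subseteq M_{p,j}$.
   Context: Notation: $[p]=\{0,\dots,p\}$. For a shape $\vec s=(n_1,\dots,n_k)$ put $n=\min(n_1,\dots,n_k)-1$, $M_a(p)=n_a-1-n+p$ (so $M_a(p)\ge p$) and $I_p=\prod_{a=1}^k[M_a(p)]$ for $p\ge 0$. Let $\delta_i^q:[q-1]\to[q]$ be the increasing injection missing $i$, and $\Delta_i^p=\prod_{a=1}^k\delta_i^{M_a(p)}:I_{p-1}\to I_p$ ($p\ge1$, $0\le i\le p$). The diagonal simplicial tensor module has $X_p=A^{I_p}$ (all functions $T:I_p\to A$) and faces $d_i^p(T)=T\circ\Delta_i^p$. For $m\in I_p$, $E_m\in X_p$ is the indicator function of $m$, and $\operatorname{supp}(T)=\{m\in I_p:T(m)\ne0\}$. Let $F_j=[p]\setminus\{j\}$. A $(p,j)$-horn is a tuple $(h_i)_{i\in F_j}$ of elements of $X_{p-1}$ with $d_i(h_\ell)=d_{\ell-1}(h_i)$ for all $i<\ell$ in $F_j$; a filler is $T\in X_p$ with $d_i(T)=h_i$ for all $i\in F_j$. The horn kernel is $R_{p,j}=\bigcap_{i\in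 F_j}\ker(d_i^p)\subseteq X_p$. An index $m\in I_p$ is missing from the $(p,j)$-horn if $m\notin\operatorname{im}(\Delta_i^p)$ for all $i\in F_j$; $M_{p,j}\subset I_p$ is the set of missing indices. *)

(* Defs.v *)
From HB Require Import structures.
From mathcomp Require Import all_boot all_order all_algebra.
Set Implicit Arguments. Unset Strict Implicit. Unset Printing Implicit Defensive.
Import GRing.Theory.
Local Open Scope ring_scope.

(* [q] = {0, .., q} is 'I_q.+1, and the increasing injection
   [q] -> [q+1] missing i is [lift i]. *)

Section Basis.
Variables (A : pzRingType) (V : lmodType A) (I : finType).

(* R is a submodule of V, free with basis the family (e m) indexed by m \in M.
   The family need not be injective, so that A may be the zero ring. *)
Definition free_with_basis (R : {pred V}) (M : {set I}) (e : I -> V) : Prop :=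
  [/\ submod_closed R,
      {in M, forall m, e m \in R},
      forall v, v \in R -> exists c : I -> A, v = \sum_(m in M) c m *: e m
    & forall c : I -> A,
        \sum_(m in M) c m *: e m = 0 -> {in M, forall m, c m = 0}].

End Basis.

Section DiagonalTensorModule.
Variables (A : comPzRingType) (k : nat) (s : 'I_k -> nat).

(* The default value \max_a s a makes this the true minimum when 0 < k. *)
Definition min_shape : nat := \big[minn/(\max_(a < k) s a)%N]_(a < k) s a.

Definition diag_dim : nat := min_shape.-1.

(* M_a(p).  No truncation occurs when s is positive, since diag_dim is then at
   most (s a).-1.  With p as the first summand, top a p.+1 is convertible to
   (top a p).+1. *)
Definition top (a : 'I_k) (p : nat) : nat := (p + ((s a).-1 - diag_dim))%N.

Lemma leq_top (a : 'I_k) (p : nat) : (p.+1 <= (top a p).+1)%N.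
Proof. by rewrite ltnS leq_addr. Qed.

Definition multi_index (p : nat) : finType :=
  {dffun forall a : 'I_k, 'I_(top a p).+1}.

Definition Delta (p : nat) (i : 'I_p.+2) (m : multi_index p) :
    multi_index p.+1 :=
  finfun (fun a : 'I_k =>
    lift (widen_ord (leq_top a p.+1) i) (m a) : 'I_(top a p.+1).+1).

Definition tensor (p : nat) : lmodType A := {ffun multi_index p -> A^o}.

Definition face (p : nat) (i : 'I_p.+2) (T : tensor p.+1) : tensor p :=
  [ffun m => T (Delta i m)].

Definition indicator (p : nat) (m : multi_index p) : tensor p :=
  [ffun m' => (m' == m)%:R].

(* F_j = [p] \ {j} *)
Definition horn_index (p : nat) (j : 'I_p.+1) : finType :=
  {i : 'I_p.+1 | i != j}.

(* The (p.+1, j)-horns.  For p = 0 the index set F_j is a singleton, so there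
   is no pair i < l and no condition.  Otherwise i < l forces both i and l.-1
   to be at most p, so both [inord] are exact. *)
Definition is_horn (p : nat) :
    forall j : 'I_p.+2, (horn_index j -> tensor p) -> Prop :=
  match p with
  | 0 => fun _ _ => True
  | q.+1 => fun j h => forall i l : horn_index j, (val i < val l)%N ->
      face (inord (val i)) (h l) = face (inord (val l).-1) (h i)
  end.

Definition is_filler (p : nat) (j : 'I_p.+2) (h : horn_index j -> tensor p)
    (T : tensor p.+1) : Prop :=
  forall i : horn_index j, face (val i) T = h i.

Definition horn_kernel (p : nat) (j : 'I_p.+2) : {pred tensor p.+1} :=
  [pred T | [forall i : horn_index j, face (val i) T == 0]].

Definition missing (p : nat) (j : 'I_p.+2) : {set multi_index p.+1} :=
  [set m | [forall i : horn_index j, m \notin codom (Delta (val i))]].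

End DiagonalTensorModule.

(* Main.v *)
(* The condition [face i T = 0] says that T vanishes on the image of [Delta i],
   so the horn kernel consists of the tensors supported on the missing
   indices. *)
Require Import Defs.
From HB Require Import structures.
From mathcomp Require Import all_boot all_order all_algebra.
Set Implicit Arguments. Unset Strict Implicit. Unset Printing Implicit Defensive.
Import GRing.Theory.
Local Open Scope ring_scope.

(** Faces are restrictions along [Delta i], and the complement of the missing set is the union of
    the images for [i != j]. So membership in the kernel is a pointwise vanishing condition
    ([horn_kernelP]), and functions vanishing off a finite set are free on its indicators, the
    coordinates being the values ([sum_indicatorE]). Two fillers share all faces of the horn, so
    their difference lies in the kernel. *)

Section HornKernel.
Variables (A : comPzRingType) (k : nat) (s : 'I_k -> nat) (p : nat).
Implicit Types (j : 'I_p.+2) (T : tensor A s p.+1).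

Lemma horn_kernelP j T :
  reflect (forall m, m \notin missing s j -> T m = 0) (T \in horn_kernel j).
Proof.
apply: (iffP forallP) => [T0 m | T0 i].
  rewrite inE negb_forall => /existsP[i]; rewrite negbK => /codomP[m' ->].
  by have /eqP/ffunP/(_ m') := T0 i; rewrite !ffunE.
apply/eqP/ffunP => m; rewrite !ffunE; apply: T0.
by rewrite inE negb_forall; apply/existsP; exists i; rewrite negbK codom_f.
Qed.

(** Evaluation recovers the coefficients, which yields both spanning and independence. *)
Lemma sum_indicatorE (q : nat) (M : {set multi_index s q})
    (c : multi_index s q -> A) x :
  (\sum_(m in M) c m *: indicator A m : tensor A s q) x
    = if x \in M then c x else 0.
Proof.
rewrite sum_ffunE; under eq_bigr do rewrite !ffunE.
case: ifPn => xM.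
  (* On [A^o] scaling is multiplication in [A], hence [mulr1]. *)
  rewrite (bigD1 x) //= eqxx [_ *: _]mulr1 big1 ?addr0 // => m /andP[_ mx].
  by rewrite eq_sym (negPf mx) scaler0.
rewrite big1 // => m mM; case: eqP => [xm|_]; last by rewrite scaler0.
by rewrite xm mM in xM.
Qed.

End HornKernel.

(* The simplicial degree p >= 1 is written p.+1. *)
Theorem theorem3p7 (A : comPzRingType) (k : nat) (k_gt0 : (0 < k)%N)
    (s : 'I_k -> nat) (s_gt0 : forall a, (0 < s a)%N)
    (p : nat) (j : 'I_p.+2) :
  free_with_basis (@horn_kernel A k s p j) (@missing k s p j)
    (@indicator A k s p.+1)
  /\ (forall (h : horn_index j -> tensor A s p), is_horn h ->
      forall T1 T2 : tensor A s p.+1, is_filler h T1 -> is_filler h T2 ->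
      support ((T1 - T2 : tensor A s p.+1) : multi_index s p.+1 -> A)
        \subset missing s j).
Proof.
split; first split.
- split=> [|a u v /horn_kernelP u0 /horn_kernelP v0]; apply/horn_kernelP => m mM.
    by rewrite ffunE.
  by rewrite !ffunE u0 // v0 // scaler0 addr0.
- move=> m mM; apply/horn_kernelP => x xM; rewrite ffunE; case: eqP => // xm.
  by rewrite xm mM in xM.
(* The coefficient at [m] is the value [v m]. *)
- move=> v /horn_kernelP v0; exists v; apply/ffunP => x.
  by rewrite sum_indicatorE; case: ifPn => // /v0.
- move=> c c0 m mM; have := sum_indicatorE (missing s j) c m.
  by rewrite c0 mM ffunE.
move=> h _ T1 T2 fT1 fT2; apply/subsetP => m; apply: contraR => mM.
have /horn_kernelP/(_ m mM)-> // : (T1 - T2 : tensor A s p.+1) \in horn_kernel j.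
apply/forallP => i; apply/eqP/ffunP => x.
have /ffunP/(_ x) := etrans (fT1 i) (esym (fT2 i)).
by rewrite !ffunE => ->; rewrite subrr.
Qed.
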